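(* Let $(i_1,j_1),(i_2,j_2),\dots,(i_k,j_k)$ be pairs of integers satisfying: $1\le k\le n$; $1\le i_1<i_2<\cdots<i_k=n$; $1=j_1<j_2<\cdots<j_k$; and $j_s\le i_{s-1}+1$ for all $2\le s\le k$. Let $\sigma$ be constructed as follows. First set $\sigma(i_s)=j_s$ for all $s\in\{1,\dots,k\}$. Then, for each $i\in[n]\setminus\{i_1,\dots,i_k\}$ taken in decreasing order, let $s$ be such that $i_{s-1}<i<i_s$ (with $i_0=0$); with $\sigma$ denoting the partial injective map defined so far, set $\sigma(i)=\sigma^{-t}(j_s)$, where $t$ is the smallest positive integer such that $\sigma^{-t}(j_s)$ has not yet been assigned as the image of any integer. Then $\sigma$ is a permutation of $[n]$ whose anti-exceedances are exactly $i_1,i_2,\dots,i_k$, with $\sigma(i_s)=j_s$, and its nom code is $$\phi^{-1}(\sigma)=1^{i_1}\,j_2^{\,i_2-i_1}\cdots j_k^{\,n-i_{k-1}}$$ (the word consisting of $i_1$ letters $1$, followed by $i_2-i_1$ letters $j_2$, ..., followed by $n-i_{k-1}$ letters $j_k$).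
   Context: $[n]=\{1,\dots,n\}$, $\mathfrak{S}_n$ the symmetric group on $[n]$; products of permutations are composed with the leftmost factor acting first: $(\alpha\beta)(x)=\beta(\alpha(x))$. During the construction, $\sigma^{-1}(y)$ denotes the unique $x$ whose image $\sigma(x)=y$ has already been defined, and $\sigma^{-t}=\sigma^{-1}\circ\sigma^{-(t-1)}$ (this construction is well defined). A function $f:[n]\to[n]$ is subexceedant if $1\le f(i)\le i$ for all $i$, written as the word $f_1\cdots f_n$; $F_n$ is the set of such functions. $\phi:F_n\to\mathfrak{S}_n$, $\phi(f)=(1,f_1)(2,f_2)\cdots(n,f_n)$ (with $(i,i)$ the identity), is a bijection, and $\phi^{-1}(\sigma)$ is called the nom code of $\sigma$. An anti-exceedance of $\sigma$ is an $i$ with $\sigma(i)\le i$. *)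

(* Defs.v *)
From mathcomp Require Import all_boot all_fingroup.

Set Implicit Arguments.
Unset Strict Implicit.
Unset Printing Implicit Defensive.

(** Conventions.  A permutation of [n] = {1, ..., n} is an element of ['S_n],
    where [x : 'I_n] stands for the element [x.+1] of [n].  The data [i], [j],
    the partial map under construction and the words use the actual numbers
    1, ..., n.  In MathComp [(a * b) x = b (a x)]: the leftmost factor acts
    first. *)

Definition subexceedant n (f : {ffun 'I_n -> 'I_n}) : bool :=
  [forall x, f x <= x].

Definition F n := {f : {ffun 'I_n -> 'I_n} | subexceedant f}.

Definition phi n (f : F n) : 'S_n := (\prod_(x < n) tperm x (val f x))%g.

Definition word n (f : F n) : seq nat :=
  [seq (val f x).+1 | x <- enum 'I_n].

Lemma F_le n (f : F n) x : val f x <= x.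
Proof. by have /forallP := valP f. Qed.

Lemma card_F n : #|{: F n}| = n`!.
Proof.
rewrite card_sig.
transitivity #|family (fun x : 'I_n => [pred y : 'I_n | y <= x])|.
  by apply: eq_card => f; apply/forallP/familyP.
rewrite card_family foldrE big_map big_enum /= fact_prod big_add1 /= big_mkord.
apply: eq_bigr => x _.
rewrite -[RHS]card_ord -(card_codom (f := widen_ord (ltn_ord x))); last first.
  by move=> a b /(congr1 val) /= /val_inj.
apply: eq_card => y; apply/idP/codomP => [le_yx | [z ->]].
  by exists (Ordinal (le_yx : y < x.+1)); apply: val_inj.
exact: (ltn_ord z).
Qed.

Lemma phi_inj n : injective (@phi n).
Proof.
move=> f g.
pose P (h : F n) m := (\prod_(x < n | x < m) tperm x (val h x))%g.
have PE h m (Hm : m < n) :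
    P h m.+1 = (P h m * tperm (Ordinal Hm) (val h (Ordinal Hm)))%g.
  pose t k := if insub k is Some x then tperm x (val h x) else 1%g : 'S_n.
  have tE (x : 'I_n) : tperm x (val h x) = t x by rewrite /t valK.
  have Pt p : p <= n -> P h p = (\prod_(0 <= k < p) t k)%g.
    move=> le_pn; rewrite big_mkord (big_ord_widen n t le_pn).
    by apply: eq_bigr.
  by rewrite !Pt ?(ltnW Hm) // big_nat_recr //= (tE (Ordinal Hm)).
have Pfix h m (y : 'I_n) : m <= y -> P h m y = y.
  move=> le_my; rewrite /P; elim/big_ind: _ => [|a b Ha Hb|x lt_xm].
  - by rewrite perm1.
  - by rewrite permM Ha Hb.
  have lt_xy := leq_trans lt_xm le_my.
  rewrite tpermD // -val_eqE /= neq_ltn ?lt_xy //.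
  by rewrite (leq_ltn_trans (F_le h x) lt_xy).
have main m : m <= n -> P f m = P g m ->
    forall x : 'I_n, x < m -> val f x = val g x.
  elim: m => [//|m IHm] lt_mn; rewrite !(PE _ _ lt_mn) => eq_P.
  have eq_m : val f (Ordinal lt_mn) = val g (Ordinal lt_mn).
    have := congr1 (fun s : 'S_n => s (Ordinal lt_mn)) eq_P.
    by rewrite !permM !Pfix // !tpermL.
  move: eq_P; rewrite eq_m => /mulIg eq_P x; rewrite ltnS leq_eqVlt.
  case/orP=> [/eqP eq_xm | ]; last exact: (IHm (ltnW lt_mn) eq_P).
  by rewrite (_ : x = Ordinal lt_mn) //; apply: val_inj.
have PT h : P h n = phi h by apply: eq_bigl => x; rewrite ltn_ord.
move=> eq_fg; apply/val_inj/ffunP => x.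
by apply: (main n) => //; rewrite !PT.
Qed.

Lemma phi_bij n : bijective (@phi n).
Proof. by apply: inj_card_bij (@phi_inj n) _; rewrite card_F card_Sn. Qed.

Lemma phi_surj n (s : 'S_n) : exists f : F n, phi f == s.
Proof. by have [g _ gK] := phi_bij n; exists (g s); rewrite gK. Qed.

Definition nom_code n (s : 'S_n) : F n := xchoose (phi_surj s).

Lemma nom_codeK n : cancel (@nom_code n) (@phi n).
Proof. by move=> s; apply/eqP/(xchooseP (phi_surj s)). Qed.

Lemma phiK n : cancel (@phi n) (@nom_code n).
Proof. by move=> f; apply: phi_inj; rewrite nom_codeK. Qed.

Definition antiexceedances n (s : 'S_n) : {set 'I_n} := [set x | s x <= x].

(** Partial maps from {1, ..., n} to itself; [None] means "not yet defined". *)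
Definition pmap := nat -> option nat.

Definition assigned n (s : pmap) (y : nat) : bool :=
  has (fun x => s x == Some y) (iota 1 n).

Definition pinv n (s : pmap) (y : nat) : option nat :=
  ohead [seq x <- iota 1 n | s x == Some y].

Definition pinv_iter n (s : pmap) (t y : nat) : option nat :=
  iter t (obind (pinv n s)) (Some y).

Definition unassigned_at n (s : pmap) (y t : nat) : bool :=
  if pinv_iter n s t y is Some z then ~~ assigned n s z else false.

(** [s^{-t}(y)] for the smallest [t > 0] such that it is defined and is not yet
    an image.  Only [t <= n] is searched: if such a [t] exists, then [y],
    [s^{-1}(y)], ..., [s^{-t}(y)] are pairwise distinct for the least one.  If
    there is none, the result is [None]. *)
Definition first_unassigned n (s : pmap) (y : nat) : option nat :=
  obind (fun t => pinv_iter n s t y)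
    (ohead [seq t <- iota 1 n | unassigned_at n s y t]).

Definition initial k (i j : nat -> nat) : pmap :=
  fun x => omap j (ohead [seq s <- iota 1 k | i s == x]).

(** The index [s] with [i (s-1) < x < i s]; here [i 0] is meant to be 0. *)
Definition block k (i : nat -> nat) (x : nat) : option nat :=
  ohead [seq s <- iota 1 k | i s.-1 < x < i s].

Definition extend n k (i j : nat -> nat) (s : pmap) (x : nat) : pmap :=
  fun y => if y == x then obind (fun r => first_unassigned n s (j r)) (block k i x)
           else s y.

Definition construct n k (i j : nat -> nat) : pmap :=
  foldl (extend n k i j) (initial k i j)
    [seq x <- rev (iota 1 n) | x \notin [seq i s | s <- iota 1 k]].

(* Main.v *)
(** Let [sigma = phi f] be the permutation whose nom code [f] is the claimed
    word.  Following the partial products of [phi f], the image of [x] becomes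
    [f x] at step [x], and at a later step [m] it changes exactly when it equals
    [f m], in which case it becomes [m].  Hence [sigma x = j_s] when [x = i_s],
    because no later letter is [j_s], whereas [sigma x > x] when [x] is followed
    by an equal letter.  Moreover, by descending induction on [x], the orbit of
    [sigma x] under [sigma] reaches [f x] through elements [> x] only.  When the
    construction treats [x], [sigma] is already known on these elements, and so
    going back from [j_s = f x] first meets an unassigned value at [sigma x]. *)
Require Import Defs.
From mathcomp Require Import all_boot all_fingroup.
From mathcomp Require Import zify.

Set Implicit Arguments.
Unset Strict Implicit.
Unset Printing Implicit Defensive.

(** The searches in [pinv], [first_unassigned], [initial] and [block] all have this form. *)
Lemma ohead_filter_iota (p : pred nat) m n t :
  m <= t < m + n -> p t -> (forall u, m <= u < t -> ~~ p u) ->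
  ohead [seq u <- iota m n | p u] = Some t.
Proof.
elim: n m => [|n IHn] m; first by lia.
move=> mt pt before /=; have [eq_mt | ne_mt] := eqVneq m t.
  by rewrite eq_mt pt.
rewrite (negbTE (before m _)); last by lia.
by apply: IHn => // [|u ltu]; [lia | apply: before; lia].
Qed.

(** * Partial products of [phi f] and orbits of the full product *)

Section Prefix.

Variables (n : nat) (f : F n).

(** Extended by the identity beyond ['I_n], so that partial products run over [nat] and the last
    factor splits off. *)
Definition nth_transposition k : 'S_n :=
  if insub k is Some x then tperm x (val f x) else 1%g.

Definition prefix m : 'S_n := (\prod_(0 <= k < m) nth_transposition k)%g.

Lemma phi_prefix : phi f = prefix n.
Proof.
rewrite /phi /prefix big_mkord; apply: eq_bigr => x _.
by rewrite /nth_transposition valK.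
Qed.

Lemma prefixS (x : 'I_n) : prefix x.+1 = (prefix x * tperm x (val f x))%g.
Proof. by rewrite /prefix big_nat_recr //= /nth_transposition valK. Qed.

Lemma prefix_fix m (x : 'I_n) : m <= x -> prefix m x = x.
Proof.
elim: m => [|m IHm] lt_mx; first by rewrite /prefix big_nil perm1.
pose y := Ordinal (ltn_trans lt_mx (ltn_ord x)).
rewrite (prefixS y) permM /= IHm ?(ltnW lt_mx) // tpermD // -val_eqE /=.
  by lia.
by have := F_le f y; rewrite /=; lia.
Qed.

Lemma prefix_self (x : 'I_n) : prefix x.+1 x = val f x.
Proof. by rewrite prefixS permM prefix_fix // tpermL. Qed.

Lemma prefix_lt m (x : 'I_n) : x < m <= n -> prefix m x < m.
Proof.
elim: m => [|m IHm] // /andP[]; rewrite ltnS leq_eqVlt => /orP[/eqP <- | lt_xm] lt_mn.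
  by rewrite prefix_self ltnS F_le.
rewrite (prefixS (Ordinal lt_mn)) permM /=.
have := IHm; rewrite lt_xm (ltnW lt_mn) => /(_ isT) lt_m.
by case: tpermP => [_|_ //|_ _]; [rewrite ltnS F_le | rewrite ltnW].
Qed.

Lemma prefix_step (x y : 'I_n) : x < y ->
  prefix y.+1 x = if prefix y x == val f y then y else prefix y x.
Proof.
move=> lt_xy; rewrite prefixS permM.
have lt_y : prefix y x < y by rewrite prefix_lt // lt_xy ltnW.
case: ifPn => [/eqP -> | ne_f]; first by rewrite tpermR.
by rewrite tpermD //; [rewrite -val_eqE /=; lia | rewrite eq_sym].
Qed.

(** A step [y] keeps the image of [x] or raises it to [y], which exceeds the old image by
    [prefix_lt]. *)
Lemma prefix_homo (x : 'I_n) m p : x < m -> m <= p <= n -> prefix m x <= prefix p x.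
Proof.
move=> lt_xm; elim: p => [|p IHp]; first by lia.
rewrite leq_eqVlt => /andP[/orP[/eqP -> // | le_mp] lt_pn].
have lt_xp : x < p by lia.
apply: leq_trans (IHp _) _; first by lia.
rewrite (@prefix_step x (Ordinal lt_pn)) //=; case: ifP => // _.
by rewrite ltnW // prefix_lt // lt_xp ltnW.
Qed.

Lemma phi_last_occurrence (x : 'I_n) :
  (forall y : 'I_n, x < y -> val f y != val f x) -> phi f x = val f x.
Proof.
move=> ne_fx; rewrite phi_prefix.
suff stable m : x < m <= n -> prefix m x = val f x by rewrite stable // ltn_ord /=.
elim: m => [|m IHm] // /andP[]; rewrite ltnS leq_eqVlt => /orP[/eqP <- | lt_xm] lt_mn.
  by rewrite prefix_self.
have fixed : prefix m x = val f x by apply: IHm; rewrite lt_xm ltnW.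
rewrite (@prefix_step x (Ordinal lt_mn)) // [X in X == _]fixed fixed ifN //.
by rewrite eq_sym ne_fx.
Qed.

Lemma phi_repeated_letter (x y : 'I_n) :
  y = x.+1 :> nat -> val f y = val f x -> x < phi f x.
Proof.
move=> yE fE; rewrite phi_prefix.
(* The goal reads [x.+1 <= prefix n x]. Its left side is the image of [x] just after step [y], and
   images only grow from there. *)
have {1}<- : prefix y.+1 x = x.+1 :> nat.
  by rewrite prefix_step ?yE // prefix_self fE eqxx.
by apply: prefix_homo; have := ltn_ord y; rewrite ?yE; lia.
Qed.

Lemma phi_orbit (x : 'I_n) :
  exists2 t, iter t (phi f) (phi f x) = val f x
           & forall a, a < t -> x < iter a (phi f) (phi f x).
Proof.
have [d] := ubnP (n - x); elim: d => [|d IHd] in x * => //; rewrite ltnS => le_d.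
(* The outer induction descends on [x]; the inner one follows the image of [x] through the partial
   products. *)
suff reach m : x < m <= n ->
    exists2 t, iter t (phi f) (prefix m x) = val f x
             & forall a, a < t -> x < iter a (phi f) (prefix m x).
  by have := reach n; rewrite -phi_prefix ltn_ord leqnn => /(_ isT).
elim: m => [|m IHm] // /andP[]; rewrite ltnS leq_eqVlt => /orP[/eqP <- | lt_xm] lt_mn.
  by exists 0; rewrite ?prefix_self.
have [|t fE path_t] := IHm; first by rewrite lt_xm ltnW.
pose y := Ordinal lt_mn.
rewrite (@prefix_step x y) //=; case: eqP => [eq_y|_]; last by exists t.
have [|u yE path_u] := IHd y; first by rewrite /=; lia.
(* The image has jumped from [val f y] to [y]. One step leads from [y] to [phi f y], then [u] steps
   lead back to [val f y], and the old path of length [t] follows. *)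
exists (t + u.+1); first by rewrite iterD iterSr yE -eq_y.
move=> a lt_a; case: a lt_a => [//|a] lt_a; rewrite iterSr.
have [lt_au | le_ua] := ltnP a u; first exact: ltn_trans lt_xm (path_u a lt_au).
by rewrite -(subnK le_ua) iterD yE -eq_y path_t //; lia.
Qed.

End Prefix.

(** * Backward search in the restriction of a permutation to a set *)

Section Backtracking.

Variables (n : nat) (sigma : 'S_n) (D : pred 'I_n) (s : Defs.pmap).
Hypothesis sE : forall y : 'I_n, s y.+1 = if D y then Some (sigma y).+1 else None.

Lemma partial_eq (y z : 'I_n) : (s z.+1 == Some (sigma y).+1) = (z == y) && D y.
Proof.
rewrite sE; have [-> | ne_zy] := eqVneq z y; first by case: (D y); rewrite ?eqxx.
case: (D z) => //; apply/negbTE; apply: contra ne_zy => /eqP[] /val_inj /perm_inj ->.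
by [].
Qed.

Lemma pinv_partial (y : 'I_n) : D y -> pinv n s (sigma y).+1 = Some y.+1.
Proof.
move=> Dy; apply: ohead_filter_iota; first by have := ltn_ord y; lia.
  by rewrite partial_eq eqxx.
case=> // u /andP[_ lt_uy].
have lt_un : u < n by have := ltn_ord y; lia.
by rewrite (partial_eq y (Ordinal lt_un)) -val_eqE /= Dy andbT; lia.
Qed.

Lemma assigned_partial (y : 'I_n) : assigned n s (sigma y).+1 = D y.
Proof.
apply/hasP/idP => [[[|u]] | Dy].
- by rewrite mem_iota.
- rewrite mem_iota add1n ltnS => /andP[_ lt_un].
  by rewrite (partial_eq y (Ordinal (lt_un : u < n))) => /andP[].
exists y.+1; first by rewrite mem_iota; have := ltn_ord y; lia.
by rewrite partial_eq eqxx.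
Qed.

(** Every value met before [sigma x] on the way back is the image of a point of [D], hence assigned.
    The only preimage of [sigma x] is [x], which lies outside [D]. *)
Lemma first_unassigned_orbit (x : 'I_n) t :
  ~~ D x -> 0 < t <= n -> (forall a, a < t -> D (iter a sigma (sigma x))) ->
  first_unassigned n s (iter t sigma (sigma x)).+1 = Some (sigma x).+1.
Proof.
move=> Dx t_bounds path_t.
have back u : u <= t ->
    pinv_iter n s u (iter t sigma (sigma x)).+1
    = Some (iter (t - u) sigma (sigma x)).+1.
  elim: u => [|u IHu] lt_ut; first by rewrite subn0.
  rewrite /pinv_iter iterS -/(pinv_iter _ _ _ _) IHu ?(ltnW lt_ut) //=.
  by rewrite -subSS subSn // iterS pinv_partial // path_t; lia.
rewrite /first_unassigned (@ohead_filter_iota _ _ _ t) /=.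
- by rewrite back // subnn.
- by lia.
- by rewrite /unassigned_at back // subnn assigned_partial.
move=> u u_bounds; rewrite /unassigned_at back; last by lia.
have -> : t - u = (t - u).-1.+1 by lia.
by rewrite iterS assigned_partial path_t //; lia.
Qed.

End Backtracking.

(** Ensures that the range searched by [first_unassigned] is long enough. If two points of the path
    coincided, cancelling [sigma] would put [x] itself on the path. *)
Lemma orbit_above_bound n (sigma : 'S_n) (x : 'I_n) t :
  (forall a, a < t -> x < iter a sigma (sigma x)) -> t <= n.
Proof.
move=> above; pose g (a : 'I_t) := iter a sigma (sigma x).
suff g_inj : injective g.
  by have := leq_card g g_inj; rewrite !card_ord.
have no_return (a b : 'I_t) : a < b -> g a <> g b.
  move=> lt_ab; rewrite /g -(subnKC lt_ab) addSnnS iterD -!permX => /perm_inj.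
  rewrite permX iterS => /perm_inj eq_x.
  by have := above (b - a.+1); rewrite -eq_x ltnn; have := ltn_ord b; lia.
move=> a b eq_g; apply: val_inj => /=.
by case: (ltngtP a b) => // [/no_return | /no_return /nesym].
Qed.

(** * Blocks of positions and the word that is constant on them *)

Section Blocks.

Variables (n k : nat) (i j : nat -> nat).
Hypothesis i_0 : i 0 = 0.
Hypothesis i_1 : 1 <= i 1.
Hypothesis i_incr : forall s, 1 <= s < k -> i s < i s.+1.
Hypothesis i_k : i k = n.
Hypothesis j_1 : j 1 = 1.
Hypothesis j_incr : forall s, 1 <= s < k -> j s < j s.+1.
Hypothesis j_le : forall s, 2 <= s <= k -> j s <= i s.-1 + 1.

Lemma i_ltn r s : r < s <= k -> i r < i s.
Proof.
elim: s => [|s IHs] // /andP[]; rewrite ltnS leq_eqVlt => /orP[/eqP <- | lt_rs] lt_sk.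
  by have [->|r_gt0] := posnP r; [rewrite i_0 | apply: i_incr; rewrite r_gt0].
apply: ltn_trans (IHs _) (i_incr _); lia.
Qed.

Lemma i_leq r s : r <= s <= k -> i r <= i s.
Proof.
by case/andP; rewrite leq_eqVlt => /orP[/eqP -> | lt_rs] le_sk //; rewrite ltnW ?i_ltn ?lt_rs.
Qed.

Lemma j_ltn r s : 0 < r -> r < s <= k -> j r < j s.
Proof.
move=> r_gt0; elim: s => [|s IHs] // /andP[]; rewrite ltnS leq_eqVlt.
case/orP=> [/eqP <- | lt_rs] lt_sk; first by apply: j_incr; rewrite r_gt0.
apply: ltn_trans (IHs _) (j_incr _); lia.
Qed.

Lemma j_neq r s : 0 < r <= k -> 0 < s <= k -> r != s -> j r != j s.
Proof.
move=> r_bounds s_bounds; case: (ltngtP r s) => // [lt_rs | lt_sr] _.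
  by rewrite neq_ltn j_ltn ?lt_rs; lia.
by rewrite neq_ltn (@j_ltn s r) ?lt_sr ?orbT; lia.
Qed.

Lemma j_gt0 s : 0 < s <= k -> 0 < j s.
Proof.
case: s => [|[|s]] // s_bounds; first by rewrite j_1.
by apply: leq_ltn_trans (@j_ltn 1 s.+2 _ _).
Qed.

(** Unlike [block], this is total and puts the endpoint [i s] in block [s]. The list starts at 0, so
    that the position found is the block number. *)
Definition block_of x := find (fun s => x <= i s) (iota 0 k.+1).

Lemma block_of_eq s x : 0 < s <= k -> i s.-1 < x <= i s -> block_of x = s.
Proof.
move=> s_bounds x_bounds; rewrite /block_of.
have has_x : has (fun s => x <= i s) (iota 0 k.+1).
  by apply/hasP; exists s; rewrite ?mem_iota; lia.
have := nth_find 0 has_x; have := has_x; rewrite has_find size_iota.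
set r := find _ _ => lt_rk; rewrite nth_iota // add0n => le_xr.
case: (ltngtP r s) => // [lt_rs | lt_sr].
  by have := @i_leq r s.-1; lia.
have := @before_find _ 0 (fun s => x <= i s) (iota 0 k.+1) s lt_sr.
by rewrite nth_iota ?add0n; lia.
Qed.

Lemma block_exists x : 0 < x <= n -> exists2 s, 0 < s <= k & i s.-1 < x <= i s.
Proof.
move=> /andP[x_gt0]; rewrite -i_k; move: (leqnn k).
elim: {1 3}k => [|m IHm] lt_mk le_xm; first by rewrite i_0 in le_xm; lia.
have [/IHm | lt_mx] := leqP x (i m); first by apply; exact: ltnW.
by exists m.+1; rewrite //= lt_mx.
Qed.

Lemma nom_word m : m <= k ->
  flatten [seq nseq (i s - i s.-1) (j s) | s <- iota 1 m]
  = [seq j (block_of x) | x <- iota 1 (i m)].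
Proof.
elim: m => [|m IHm] lt_mk; first by rewrite i_0.
have lt_i : i m < i m.+1 by apply: i_ltn; rewrite ltnSn.
rewrite -[in LHS](addn1 m) iotaD map_cat flatten_cat IHm ?(ltnW lt_mk) //= cats0 add1n /=.
rewrite -[in RHS](subnKC (ltnW lt_i)) iotaD map_cat; congr (_ ++ _).
set w := map _ (iota _ _).
have -> : i m.+1 - i m = size w by rewrite size_map size_iota.
apply/esym/all_pred1P/allP => _ /mapP[x x_bounds ->] /=.
by rewrite (@block_of_eq m.+1) //=; move: x_bounds; rewrite mem_iota; lia.
Qed.

(** This is where [j_le] enters: in a block [s >= 2], [j s] is at most [i s.-1 + 1], hence at most
    [x.+1]. *)
Lemma code_bound (x : 'I_n) : (j (block_of x.+1)).-1 <= x.
Proof.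
have [|s s_bounds x_bounds] := @block_exists x.+1; first by have := ltn_ord x.
rewrite (block_of_eq s_bounds x_bounds).
case: s s_bounds x_bounds => [|[|s]] //; first by rewrite j_1.
by move=> s_bounds /=; have := @j_le s.+2 s_bounds; rewrite /=; lia.
Qed.

Definition code_fun : {ffun 'I_n -> 'I_n} :=
  [ffun x => Ordinal (leq_ltn_trans (code_bound x) (ltn_ord x))].

Lemma code_subexceedant : subexceedant code_fun.
Proof. by apply/forallP => x; rewrite ffunE code_bound. Qed.

Definition code : F n := exist _ code_fun code_subexceedant.

Lemma code_exists : exists f : F n, forall s (x : 'I_n),
  0 < s <= k -> i s.-1 < x.+1 <= i s -> (val f x).+1 = j s.
Proof.
exists code => s x s_bounds x_bounds.
by rewrite ffunE /= (block_of_eq s_bounds x_bounds) prednK ?j_gt0.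
Qed.

(** * The permutation coded by the block word *)

Variable f : F n.
Hypothesis fE : forall s (x : 'I_n),
  0 < s <= k -> i s.-1 < x.+1 <= i s -> (val f x).+1 = j s.

Let I := [seq i s | s <- iota 1 k].

Lemma word_code :
  word f = flatten [seq nseq (i s - i s.-1) (j s) | s <- iota 1 k].
Proof.
rewrite nom_word // i_k /word (iotaDl 1 0 n) -val_enum_ord -!map_comp.
apply: eq_map => x /=; have [|s s_bounds x_bounds] := @block_exists x.+1.
  by have := ltn_ord x.
by rewrite (fE s_bounds x_bounds) (block_of_eq s_bounds).
Qed.

(** Later positions lie in other blocks, whose letters differ since [j] is strictly increasing. *)
Lemma phi_block_end s (x : 'I_n) :
  0 < s <= k -> x.+1 = i s -> phi f x = val f x.
Proof.
move=> s_bounds xE; apply: phi_last_occurrence => y lt_xy.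
have [|r r_bounds y_bounds] := @block_exists y.+1; first by have := ltn_ord y.
have x_bounds : i s.-1 < x.+1 <= i s by rewrite xE leqnn i_ltn //; lia.
have ne_rs : r != s by apply/eqP => eq_rs; move: y_bounds; rewrite eq_rs -xE; lia.
have := j_neq r_bounds s_bounds ne_rs.
rewrite -(fE r_bounds y_bounds) -(fE s_bounds x_bounds).
by apply: contra => /eqP ->.
Qed.

(** The next position lies in the same block and so carries the same letter. *)
Lemma phi_block_interior (x : 'I_n) : x.+1 \notin I -> x < phi f x.
Proof.
move=> xI; have [|s s_bounds x_bounds] := @block_exists x.+1.
  by have := ltn_ord x.
have lt_x : x.+1 < i s.
  rewrite ltn_neqAle; case/andP: x_bounds => _ ->; rewrite andbT.
  by apply: contra xI => /eqP ->; apply: map_f; rewrite mem_iota; lia.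
have lt_xn : x.+1 < n by apply: leq_trans lt_x _; rewrite -i_k i_leq //; lia.
apply: (@phi_repeated_letter _ f x (Ordinal lt_xn)) => //.
by apply/val_inj/succn_inj; rewrite (fE s_bounds x_bounds) (fE s_bounds) /=; lia.
Qed.

Lemma phi_mem_block_end s (x : 'I_n) :
  0 < s <= k -> x.+1 = i s -> (phi f x).+1 = j s.
Proof.
move=> s_bounds xE; rewrite (phi_block_end s_bounds xE); apply: fE => //.
by rewrite xE leqnn i_ltn //; lia.
Qed.

Lemma antiexceedances_phi (x : 'I_n) : (x \in antiexceedances (phi f)) = (x.+1 \in I).
Proof.
rewrite inE; apply/idP/idP => [le_x | /mapP[s]].
  by apply/negPn/negP => /phi_block_interior; lia.
rewrite mem_iota => s_bounds xE.
by rewrite (phi_block_end (s := s)) ?F_le //; lia.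
Qed.

(** * The run of the construction *)

Lemma initial_block_end s : 0 < s <= k -> initial k i j (i s) = Some (j s).
Proof.
move=> s_bounds; rewrite /initial (@ohead_filter_iota _ _ _ s) // => u u_bounds.
by rewrite neq_ltn i_ltn //; lia.
Qed.

Lemma initial_other x : x \notin I -> initial k i j x = None.
Proof.
move=> xI; rewrite /initial (@eq_in_filter _ _ pred0) ?filter_pred0 // => s s_in.
by apply: contraNF xI => /eqP <-; apply: map_f.
Qed.

Lemma block_interior s x : 0 < s <= k -> i s.-1 < x < i s -> block k i x = Some s.
Proof.
move=> s_bounds x_bounds; apply: ohead_filter_iota => // u u_bounds.
by have := @i_leq u s.-1; lia.
Qed.

(** Invariant of the construction: once the numbers above [m] are treated, the partial map is
    [phi f] restricted to them and to [I]. The case [m = 0] is the finished construction. *)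
Lemma construct_partial m d (y : 'I_n) : m + d = n ->
  foldl (extend n k i j) (initial k i j)
    [seq x <- rev (iota m.+1 d) | x \notin I] y.+1
  = if (y.+1 \in I) || (m <= y) then Some (phi f y).+1 else None.
Proof.
elim: d m y => [|d IHd] m y mdn.
  rewrite /= leqNgt -[m]addn0 mdn ltn_ord orbF; case: ifPn => [/mapP[s]|]; last first.
    exact: initial_other.
  rewrite mem_iota => s_bounds yE; rewrite yE initial_block_end; last by lia.
  by rewrite (@phi_mem_block_end s) //; lia.
(* Because of [rev], the smallest number [m.+1] is treated last. *)
rewrite /= rev_cons filter_rcons; rewrite -addSnnS in mdn.
have [mI | mI] := boolP (m.+1 \in I) => /=.
  rewrite IHd //; have [eq_my | ne_my] := eqVneq m y; first by rewrite -eq_my mI.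
  by rewrite ltn_neqAle ne_my.
rewrite foldl_rcons; set s := foldl _ _ _.
pose D (z : 'I_n) := (z.+1 \in I) || (m < z).
have sE (z : 'I_n) : s z.+1 = if D z then Some (phi f z).+1 else None by apply: IHd.
rewrite /extend eqSS; have [eq_ym | ne_ym] := eqVneq (y : nat) m; last first.
  by rewrite sE /D ltn_neqAle eq_sym ne_ym.
rewrite -eq_ym in mI *; rewrite leqnn orbT.
have [|r r_bounds y_bounds] := @block_exists y.+1; first by have := ltn_ord y.
have ne_y : y.+1 != i r.
  by apply: contraNneq mI => ->; apply: map_f; rewrite mem_iota; lia.
rewrite (@block_interior r) //=; last by lia.
(* The search starts from [j r], the letter at [y], which the orbit of [phi f y] reaches in [t]
   steps through points above [y], all of them in [D]. *)
have [t tE path_t] := phi_orbit f y.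
rewrite -(fE r_bounds y_bounds) -tE.
apply: (first_unassigned_orbit sE); first by rewrite /D -eq_ym ltnn orbF.
  rewrite (orbit_above_bound path_t) andbT lt0n.
  (* If [t] were 0, then [phi f y] would be [val f y], at most [y]; but [phi f y] exceeds [y] inside
     a block. *)
  apply: contraTneq (F_le f y) => t0; rewrite -ltnNge -tE t0.
  exact: phi_block_interior.
by move=> a lt_at; rewrite /D -eq_ym path_t ?orbT.
Qed.

End Blocks.

Theorem theorem4p1 (n k : nat) (i j : nat -> nat)
  (k_bounds : 1 <= k <= n)
  (i_0 : i 0 = 0)
  (i_1 : 1 <= i 1)
  (i_incr : forall s, 1 <= s < k -> i s < i s.+1)
  (i_k : i k = n)
  (j_1 : j 1 = 1)
  (j_incr : forall s, 1 <= s < k -> j s < j s.+1)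
  (j_le : forall s, 2 <= s <= k -> j s <= i s.-1 + 1) :
  exists sigma : 'S_n,
    [/\ forall x : 'I_n, construct n k i j x.+1 = Some (sigma x).+1,
        forall x : 'I_n,
          (x \in antiexceedances sigma) = (x.+1 \in [seq i s | s <- iota 1 k]),
        forall (s : nat) (x : 'I_n),
          1 <= s <= k -> x.+1 = i s -> (sigma x).+1 = j s
      & word (nom_code sigma) =
          flatten [seq nseq (i s - i s.-1) (j s) | s <- iota 1 k]].
Proof.
have [f fE] := code_exists i_0 i_1 i_incr i_k j_1 j_incr j_le.
exists (phi f); split.
- move=> x; have := construct_partial i_0 i_1 i_incr i_k j_1 j_incr fE x (add0n n).
  by rewrite orbT.
- exact: antiexceedances_phi i_0 i_1 i_incr i_k j_1 j_incr f fE.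
- exact: phi_mem_block_end i_0 i_1 i_incr i_k j_1 j_incr f fE.
- by rewrite phiK; exact: word_code i_0 i_1 i_incr i_k j_1 f fE.
Qed.
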